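(* Let $V$ be the evaluation function of a weighted separable attribute model with utility function $u$ and weight function $w$, and let $u^{0}(t)=u(t)w(t,0)$ for $t\in\mathbb{R}$. The following two statements are equivalent. (a) Both of the following hold: (Injective) for all real $t>s>0$, $u^{0}(t)\neq u^{0}(s)$; and (Symmetry) for all real $t>0$, $u^{0}(t)=-u^{0}(-t)$. (b) For all real $x_{1},x_{2}$ with $x_{1}x_{2}<0$, with the two-attribute alternatives $x=(x_{1},x_{2})$ and $y=(0,0)$, one has $V(x|\{x,y\})=V(y|\{y,x\})$ if and only if $x_{1}=-x_{2}$. The result also holds when the alternatives have additional attributes with constants: for every $N\geq 3$ and all $c_{3},\dots,c_{N}\in\mathbb{R}$, (a) is equivalent to the statement obtained from (b) by replacing $x$ and $y$ with $x=(x_{1},x_{2},c_{3},\dots,c_{N})$ and $y=(0,0,c_{3},\dots,c_{N})$.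
   Context: An alternative is a vector $x=(x_{1},\dots,x_{N})\in\mathbb{R}^{N}$ of attribute values. A utility function is a weakly increasing function $u:\mathbb{R}\to\mathbb{R}$ with $u(0)=0$ (and $|u(t)|<\infty$ for all $t\in\mathbb{R}$). A weight function is any function $w:\mathbb{R}\times\mathbb{R}\to\mathbb{R}_{+}=[0,\infty)$ (with $w(t,s)<\infty$ for all $t,s\in\mathbb{R}$). A weighted separable attribute model, given by $u$ and $w$ (the same $u$ and $w$ for all attributes), evaluates an alternative $x$ in a binary menu $\{x,y\}$, where $x,y\in\mathbb{R}^{N}$ satisfy $x_{n}y_{n}\geq 0$ for all $n$, by $$V(x|\{x,y\})=\sum_{n=1}^{N}u(x_{n})\,w(x_{n},y_{n}).$$ In $V(x|\{x,y\})$, $x$ is the evaluated alternative and $y$ the comparison alternative, so $V(y|\{y,x\})=\sum_{n=1}^{N}u(y_{n})\,w(y_{n},x_{n})$. *)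

(* Defs.v *)
From HB Require Import structures.
From mathcomp Require Import all_boot all_order all_algebra.
From mathcomp Require Import reals.

Set Implicit Arguments.
Unset Strict Implicit.
Unset Printing Implicit Defensive.

Import Order.TTheory GRing.Theory Num.Theory.
Local Open Scope ring_scope.

Definition utility_function (R : realType) (u : R -> R) : Prop :=
  {homo u : s t / s <= t} /\ u 0 = 0.

Definition weight_function (R : realType) (w : R -> R -> R) : Prop :=
  forall t s, 0 <= w t s.

(* V(x|{x,y}): x is the evaluated alternative, y the comparison alternative.
   The model only evaluates menus with x_n * y_n >= 0 for all n; the formula is
   total here, and should be read only on menus meeting that condition. *)
Definition evaluation (R : realType) (u : R -> R) (w : R -> R -> R) (N : nat)
    (x y : 'rV[R]_N) : R :=
  \sum_(n < N) u (x ord0 n) * w (x ord0 n) (y ord0 n).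

Definition u0 (R : realType) (u : R -> R) (w : R -> R -> R) (t : R) : R :=
  u t * w t 0.

Definition injective_attr (R : realType) (u : R -> R) (w : R -> R -> R) : Prop :=
  forall t s : R, t > s -> s > 0 -> u0 u w t <> u0 u w s.

Definition symmetry_attr (R : realType) (u : R -> R) (w : R -> R -> R) : Prop :=
  forall t : R, t > 0 -> u0 u w t = - u0 u w (- t).

Definition alt2 (R : realType) (x1 x2 : R) : 'rV[R]_2 :=
  \row_(n < 2) (if n == ord0 then x1 else x2).

(* Main.v *)
Require Import Defs.
From HB Require Import structures.
From mathcomp Require Import all_boot all_order all_algebra.
From mathcomp Require Import reals.

Set Implicit Arguments.
Unset Strict Implicit.
Unset Printing Implicit Defensive.

Import Order.TTheory GRing.Theory Num.Theory.
Local Open Scope ring_scope.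

(** Because [u 0 = 0], the zero attributes of [y] contribute nothing, and an attribute shared by
    both alternatives adds the same term to both evaluations. So indifference, with or without
    constants, says exactly that [u0 u w x1 + u0 u w x2 = 0]. Both equivalences thus reduce to
    [injective_symmetryP], a fact about the single function [u0 u w]. *)

Lemma evaluation_alt2 (R : realType) (u : R -> R) (w : R -> R -> R)
    (x1 x2 y1 y2 : R) :
  evaluation u w (alt2 x1 x2) (alt2 y1 y2) = u x1 * w x1 y1 + u x2 * w x2 y2.
Proof. by rewrite /evaluation big_ord_recl big_ord1 !mxE. Qed.

Lemma evaluation_row_mx (R : realType) (u : R -> R) (w : R -> R -> R)
    (n m : nat) (x y : 'rV[R]_n) (c d : 'rV[R]_m) :
  evaluation u w (row_mx x c) (row_mx y d) =
  evaluation u w x y + evaluation u w c d.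
Proof.
rewrite /evaluation big_split_ord /=.
by congr (_ + _); apply: eq_bigr => i _; rewrite ?row_mxEl ?row_mxEr.
Qed.

Lemma evaluation_alt2_0 (R : realType) (u : R -> R) (w : R -> R -> R)
    (x1 x2 : R) : u 0 = 0 ->
  evaluation u w (alt2 x1 x2) (alt2 0 0) =
    evaluation u w (alt2 0 0) (alt2 x1 x2) <->
  u0 u w x1 + u0 u w x2 = 0.
Proof. by move=> u00; rewrite !evaluation_alt2 u00 !mul0r addr0. Qed.

(** Symmetry moves the negative argument to the positive half-line, turning a vanishing sum into an
    equality of two values of [u0 u w] there, which injectivity resolves. Conversely, both
    properties come from testing well-chosen pairs of opposite signs. *)
Lemma injective_symmetryP (R : realType) (u : R -> R) (w : R -> R -> R) :
  injective_attr u w /\ symmetry_attr u w <->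
  forall x1 x2 : R, x1 * x2 < 0 ->
    u0 u w x1 + u0 u w x2 = 0 <-> x1 = - x2.
Proof.
split=> [[inj sym]|H].
  (* Both sides are invariant under swapping the arguments, so one sign pattern suffices. *)
  have pos_neg a b : 0 < a -> b < 0 -> u0 u w a + u0 u w b = 0 <-> a = - b.
    move=> a0 b0; have Nb0 : 0 < - b by rewrite oppr_gt0.
    have := sym _ Nb0; rewrite opprK => symb.
    split=> [/eqP|->]; last by rewrite symb addNr.
    rewrite addr_eq0 -symb => /eqP eq_ab.
    have [ab|ba|//] := ltgtP a (- b).
    - by case: (inj _ _ ab a0).
    - by case: (inj _ _ ba Nb0).
  move=> x1 x2; have [x10|x10|->] := ltgtP x1 0; last by rewrite mul0r ltxx.
  - rewrite nmulr_rlt0// => x20; rewrite addrC pos_neg//.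
    by split=> ->; rewrite opprK.
  - by rewrite pmulr_rlt0// => x20; exact: pos_neg.
have sym : symmetry_attr u w.
  (* Test the pair [(t, - t)]. *)
  move=> t t0; apply/eqP; rewrite -addr_eq0; apply/eqP/H; last by rewrite opprK.
  by rewrite pmulr_rlt0// oppr_lt0.
split=> // t s st s0 eq_ts.
have ts : t = s.
  (* Test the pair [(t, - s)]: by [eq_ts] and the symmetry just obtained, its sum vanishes. *)
  rewrite -[s]opprK; apply/H; first by rewrite pmulr_rlt0 ?oppr_lt0 // (lt_trans s0).
  by rewrite eq_ts (sym _ s0) addNr.
by move: st; rewrite ts ltxx.
Qed.

Theorem proposition2 (R : realType) (u : R -> R) (w : R -> R -> R)
    (hu : utility_function u) (hw : weight_function w) :
  (injective_attr u w /\ symmetry_attr u w <->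
   forall x1 x2 : R, x1 * x2 < 0 ->
     let x := alt2 x1 x2 in
     let y := alt2 0 0 in
     evaluation u w x y = evaluation u w y x <-> x1 = - x2)
  /\
  (* N = 2 + m attributes, N >= 3, with constants c = (c_3, ..., c_N) *)
  (forall (m : nat) (c : 'rV[R]_m), (0 < m)%N ->
   (injective_attr u w /\ symmetry_attr u w <->
    forall x1 x2 : R, x1 * x2 < 0 ->
      let x := row_mx (alt2 x1 x2) c in
      let y := row_mx (alt2 0 0) c in
      evaluation u w x y = evaluation u w y x <-> x1 = - x2)).
Proof.
have [_ u00] := hu; split=> [|m c _]; rewrite injective_symmetryP.
  by split=> H x1 x2 /H /=; rewrite evaluation_alt2_0.
(* The block [c] is compared with itself in both menus, so its term cancels. *)
have cancel_c x1 x2 :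
    evaluation u w (row_mx (alt2 x1 x2) c) (row_mx (alt2 0 0) c) =
      evaluation u w (row_mx (alt2 0 0) c) (row_mx (alt2 x1 x2) c) <->
    u0 u w x1 + u0 u w x2 = 0.
  rewrite !evaluation_row_mx -evaluation_alt2_0//.
  by split=> [/addIr|->].
by split=> H x1 x2 /H /=; rewrite cancel_c.
Qed.
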